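(* Let $X$ be an infinite metrizable compact $C$-space. Then there does not exist a continuous linear surjection $T: C_p(X)\to C_k(X)_w$.
   Context: For a compact space $X$, $C(X)$ is the vector space of all continuous functions $X\to\mathbb{R}$; $C_p(X)$ is $C(X)$ with the topology of pointwise convergence; $C_k(X)_w$ is the Banach space $C(X)$ (sup norm) endowed with its weak topology. A normal space $X$ is a $C$-space if for every sequence $\{\mathcal{U}_n : n\in\omega\}$ of open covers of $X$ there exists a sequence $\{\mathcal{V}_n : n\in\omega\}$ of families of pairwise disjoint open subsets of $X$ such that for each $n\in\omega$ the family $\mathcal{V}_n$ refines $\mathcal{U}_n$ (each member of $\mathcal{V}_n$ is contained in some member of $\mathcal{U}_n$), and $\bigcup_{n\in\omega}\mathcal{V}_n$ is a cover of $X$. *)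

(* Defs.v *)
From HB Require Import structures.
From mathcomp Require Import all_boot all_order all_algebra.
From mathcomp Require Import all_classical all_reals all_analysis.

Set Implicit Arguments.
Unset Strict Implicit.
Unset Printing Implicit Defensive.

Import Order.TTheory GRing.Theory Num.Theory.
Import numFieldNormedType.Exports.

Local Open Scope classical_set_scope.
Local Open Scope ring_scope.

Definition metrizable (R : realType) (X : topologicalType) : Prop :=
  exists d : X -> X -> R,
    [/\ forall x y, 0 <= d x y,
        forall x y, d x y = 0 <-> x = y,
        forall x y, d x y = d y x,
        forall x y z, d x z <= d x y + d y z &
        forall x, nbhs x =
          filter_from [set e | 0 < e] (fun e => [set y | d x y < e])].

Definition open_cover (X : topologicalType) (U : set (set X)) : Prop :=
  U `<=` open /\ cover U id = [set: X].

Definition refines (X : Type) (V U : set (set X)) : Prop :=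
  forall B, V B -> exists2 A, U A & B `<=` A.

(* A family of subsets of X is a set of subsets; [trivIset V id] says that
   distinct members of V are disjoint. *)
Definition C_space (X : topologicalType) : Prop :=
  normal_space X /\
  forall U : nat -> set (set X), (forall n, open_cover (U n)) ->
  exists V : nat -> set (set X),
    (forall n, [/\ V n `<=` open, trivIset (V n) id & refines (V n) (U n)]) /\
    cover (\bigcup_n V n) id = [set: X].

Section continuous_lmodule.
Context (X : topologicalType) (R : realType).
Implicit Types f g h : continuousType X R.

Fact cts_add_subproof f g : continuous (fun x => f x + g x).
Proof. by move=> x; apply: cvgD; exact: cts_fun. Qed.

Fact cts_opp_subproof f : continuous (fun x => - f x).
Proof. by move=> x; apply: cvgN; exact: cts_fun. Qed.

Fact cts_scale_subproof (a : R) f : continuous (fun x => a * f x).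
Proof. by move=> x; apply: cvgMr; exact: cts_fun. Qed.

Fact cts_zero_subproof : continuous (fun _ : X => 0 : R).
Proof. by move=> x; exact: cvg_cst. Qed.

Definition cts_add f g : continuousType X R := mkcts (@cts_add_subproof f g).
Definition cts_opp f : continuousType X R := mkcts (@cts_opp_subproof f).
Definition cts_scale a f : continuousType X R :=
  mkcts (@cts_scale_subproof a f).
Definition cts_zero : continuousType X R := mkcts cts_zero_subproof.

Fact cts_addA : associative cts_add.
Proof. by move=> f g h; apply/continuousEP => x; exact: addrA. Qed.

Fact cts_addC : commutative cts_add.
Proof. by move=> f g; apply/continuousEP => x; exact: addrC. Qed.

Fact cts_add0 : left_id cts_zero cts_add.
Proof. by move=> f; apply/continuousEP => x; exact: add0r. Qed.

Fact cts_addN : left_inverse cts_zero cts_opp cts_add.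
Proof. by move=> f; apply/continuousEP => x; exact: addNr. Qed.

HB.instance Definition _ := GRing.isZmodule.Build (continuousType X R)
  cts_addA cts_addC cts_add0 cts_addN.

Fact cts_scaleA a b f : cts_scale a (cts_scale b f) = cts_scale (a * b) f.
Proof. by apply/continuousEP => x; exact: mulrA. Qed.

Fact cts_scale1 : left_id 1 cts_scale.
Proof. by move=> f; apply/continuousEP => x; exact: mul1r. Qed.

Fact cts_scaleDr : right_distributive cts_scale +%R.
Proof. by move=> a f g; apply/continuousEP => x; exact: mulrDr. Qed.

Fact cts_scaleDl f : {morph cts_scale^~ f : a b / a + b}.
Proof. by move=> a b; apply/continuousEP => x; exact: mulrDl. Qed.

HB.instance Definition _ := GRing.Zmodule_isLmodule.Build R
  (continuousType X R) cts_scaleA cts_scale1 cts_scaleDr cts_scaleDl.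

End continuous_lmodule.

Definition Cp (X : topologicalType) (R : realType) : Type :=
  continuousType X R.

Section Cp_structure.
Context (X : topologicalType) (R : realType).

HB.instance Definition _ := GRing.Lmodule.copy (Cp X R) (continuousType X R).
HB.instance Definition _ := Topological.copy (Cp X R)
  (initial_topology (fun f : continuousType X R => (f : {ptws X -> R}))).

End Cp_structure.

(* The compactness proof is a parameter of the type because the supremum below
   is a norm only when continuous functions are bounded. *)
Definition Ck (X : topologicalType) (R : realType)
  (cX : compact [set: X]) : Type := continuousType X R.

Section Ck_structure.
Context (X : topologicalType) (R : realType) (cX : compact [set: X]).
Local Notation C := (Ck R cX).

HB.instance Definition _ := GRing.Lmodule.copy C (continuousType X R).

Definition sup_norm (f : C) : R := sup (range (fun x => `|f x|)).

Fact sup_norm_has_ubound (f : C) : has_ubound (range (fun x => `|f x|)).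
Proof.
have cf : continuous (f : X -> R) by exact: cts_fun.
have /compact_bounded[M [_ /(_ (M + 1))]] : compact ((f : X -> R) @` setT).
  apply: continuous_compact => //; exact: continuous_subspaceT.
rewrite ltrDl ltr01 => /(_ isT) fM.
by exists (M + 1) => _ [x _ <-]; apply: fM; exists x.
Qed.

Fact sup_norm_ub (f : C) x : `|f x| <= sup_norm f.
Proof. by apply: ub_le_sup; [exact: sup_norm_has_ubound|exists x]. Qed.

Fact sup_norm_le (f : C) (M : R) :
  0 <= M -> (forall x, `|f x| <= M) -> sup_norm f <= M.
Proof.
move=> M0 fM; have [E|/set0P E] := eqVneq (range (fun x => `|f x|)) set0.
  by rewrite /sup_norm E sup0.
by apply: ge_sup => // _ [x _ <-].
Qed.

Fact sup_norm_ge0 (f : C) : 0 <= sup_norm f.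
Proof.
have [E|/set0P[_ [x _ _]]] := eqVneq (range (fun x => `|f x|)) set0.
  by rewrite /sup_norm E sup0.
exact: le_trans (sup_norm_ub f x).
Qed.

Fact sup_normD (f g : C) : sup_norm (f + g) <= sup_norm f + sup_norm g.
Proof.
apply: sup_norm_le => [|x]; first by rewrite addr_ge0// sup_norm_ge0.
by rewrite (le_trans (ler_normD _ _))// lerD// sup_norm_ub.
Qed.

Fact sup_normZ (a : R) (f : C) : sup_norm (a *: f) = `|a| * sup_norm f.
Proof.
have le b (g : C) : sup_norm (b *: g) <= `|b| * sup_norm g.
  apply: sup_norm_le => [|x]; first by rewrite mulr_ge0// sup_norm_ge0.
  by rewrite normrM ler_wpM2l// sup_norm_ub.
apply/eqP; rewrite eq_le le/=; have [->|a0] := eqVneq a 0.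
  by rewrite normr0 mul0r sup_norm_ge0.
rewrite -{1}(scalerK a0 f) mulrC -ler_pdivlMr ?normr_gt0//.
by rewrite mulrC -normfV le.
Qed.

Fact sup_norm0_eq0 (f : C) : sup_norm f = 0 -> f = 0.
Proof.
move=> f0; apply/continuousEP => x; apply/eqP.
by rewrite -normr_le0 -f0 sup_norm_ub.
Qed.

HB.instance Definition _ := Lmodule_isNormed.Build R C
  sup_normD sup_normZ sup_norm0_eq0.

End Ck_structure.

Definition dual (R : realType) (V : normedModType R) : Type :=
  {phi : {linear V -> R^o} | continuous phi}.

Definition weak (R : realType) (V : normedModType R) : Type := V.

Section weak_structure.
Context (R : realType) (V : normedModType R).

HB.instance Definition _ := GRing.Lmodule.copy (weak V) V.
HB.instance Definition _ := Topological.copy (weak V)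
  (sup_topology (fun phi : dual V => Topological.class
    (initial_topology (sval phi : V -> R^o)))).

End weak_structure.

(* Main.v *)
Require Import Defs.
From HB Require Import structures.
From mathcomp Require Import all_boot all_order all_algebra.
From mathcomp Require Import all_classical all_reals all_analysis.
From mathcomp Require Import ring lra.

Set Implicit Arguments.
Unset Strict Implicit.
Unset Printing Implicit Defensive.

Import Order.TTheory GRing.Theory Num.Theory.
Import numFieldNormedType.Exports.

Local Open Scope classical_set_scope.
Local Open Scope ring_scope.

(** A continuous linear [T] from [Cp X] to [Ck X] with its weak topology pulls
    every norm-continuous functional [phi] back to a continuous functional
    [phi \o T] on [Cp X].  Such a functional depends on the values of its
    argument at finitely many points only ([Cp_functional_determined]), and it
    is bounded for the sup norm ([Cp_functional_finite]).  When [T] is onto and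
    [X] is infinite this is too restrictive, by a gliding hump argument.

    Let [nu_x] be the functional sending [f] to [T f x].  No finite set [S]
    determines all the [nu_x]: otherwise [T] would factor through the
    restriction to [S], and its range would have dimension at most [size S],
    whereas [Ck X] is infinite-dimensional ([infinite_range]).  Hence one can
    choose successively points [x_n] and [y_n] such that [y_n] carries a nonzero
    weight [w_n] in [nu_{x_n}] but lies outside the finite supports of
    [nu_{x_0}, ..., nu_{x_{n-1}}] ([essential_point]).

    If [a_n > 0] decreases fast enough, then the sum [phi] of the [a_n] times
    the Dirac mass at [x_n] is a continuous functional on [Ck X]
    ([atomic_functional]), and [phi \o T], the sum of the [a_n nu_{x_n}], has
    nonzero weight at every [y_i]: the functionals before [i] give [y_i] no
    weight, and those after [i] contribute less than [a_i w_i] in total.  So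
    [phi \o T] is determined by no finite set ([gliding_hump]), a
    contradiction. *)

(** * Continuous functionals for pointwise convergence *)

(** The sets of functions smaller than [e] on a finite set [F] form a filter
    base that converges pointwise to [0]; hence its filter contains every
    neighbourhood of [0]. *)
Lemma Cp_nbhs0 (R : realType) (X : topologicalType) (U : set (Cp X R)) :
  nbhs (0 : Cp X R) U ->
  exists (F : seq X) (e : R), 0 < e /\
    forall f : Cp X R, (forall x, x \in F -> `|f x| < e) -> U f.
Proof.
pose G : set_system (Cp X R) :=
  filter_from [set p : seq X * R | 0 < p.2]
    (fun p => [set f : Cp X R | forall x, x \in p.1 -> `|f x| < p.2]).
have FG : Filter G.
  apply: filter_from_filter; first by exists ([::], 1); rewrite /= ltr01.
  move=> [F e] [F' e'] /= e0 e'0; exists (F ++ F', Num.min e e') => /=.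
    by rewrite lt_min e0.
  move=> f /= fFF'; split=> x xF;
    have := fFF' x; rewrite mem_cat xF ?orbT => /(_ isT);
    by rewrite lt_min => /andP[].
(* The same filter, seen among all functions, converges pointwise. *)
have G0 : (fun f : Cp X R => (f : {ptws X -> R})) @ G -->
    ((fun=> 0) : {ptws X -> R}).
  apply/pointwise_cvgP => t; apply/cvgr0Pnorm_lt => e e0.
  by exists ([:: t], e) => //= f /(_ t); rewrite inE eqxx; exact.
case=> [_ [[B oB <-] B0 sBU]].
have /G0[[F e] /= e0 FB] : nbhs ((fun=> 0) : {ptws X -> R}) B.
  exact: open_nbhs_nbhs.
by exists F, e; split=> // f /FB; exact: sBU.
Qed.

(** A functional bounded by [1] on a basic neighbourhood of [0] is bounded, by
    homogeneity, in terms of the sup of its argument on the finite set that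
    defines the neighbourhood. *)
Lemma Cp_functional_finite (R : realType) (X : topologicalType)
    (nu : {linear Cp X R -> R^o}) : {for 0, continuous nu} ->
  exists (F : seq X) (C : R), 0 < C /\
    forall (f : Cp X R) M, 0 < M -> (forall x, x \in F -> `|f x| <= M) ->
      `|nu f| <= C * M.
Proof.
move=> nu0; have /Cp_nbhs0[F [e [e0 Fe]]] :
    nbhs (0 : Cp X R) [set f | `|nu f| < 1].
  have := nu0; rewrite /prop_for /continuous_at linear0.
  by move/cvgr0Pnorm_lt => /(_ _ ltr01).
exists F, (2 / e); split=> [|f M M0 fM]; first by rewrite divr_gt0.
have K0 : 0 < e / (2 * M) by rewrite divr_gt0// mulr_gt0.
have /Fe /= : forall x, x \in F -> `|(e / (2 * M) *: f) x| < e.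
  move=> x xF; rewrite [X in `|X|](_ : _ = e / (2 * M) * f x)//.
  rewrite normrM gtr0_norm//.
  rewrite (@le_lt_trans _ _ (e / (2 * M) * M)) ?ler_wpM2l ?fM// ?ltW//.
  rewrite -[ltRHS]mulr1 -mulrA ltr_pM2l// invfM -mulrA mulVf ?gt_eqF//.
  by rewrite mulr1 invf_lt1// ltr1n.
rewrite linearZ /= normrM gtr0_norm// => /ltW.
rewrite -ler_pdivlMl// mulr1 invf_div => /le_trans; apply.
by rewrite mulrAC.
Qed.

Definition determined_by (R : realType) (X : topologicalType)
    (nu : Cp X R -> R) (F : seq X) :=
  forall f : Cp X R, (forall x, x \in F -> f x = 0) -> nu f = 0.

Lemma Cp_functional_determined (R : realType) (X : topologicalType)
    (nu : {linear Cp X R -> R^o}) : {for 0, continuous nu} ->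
  exists F, determined_by nu F.
Proof.
move=> /Cp_functional_finite[F [C [C0 nuC]]].
exists F => f fF; apply/eqP; rewrite -normr_le0; apply/ler_addgt0Pr => e e0.
rewrite add0r (le_trans (nuC f (e / C) _ _)) ?divr_gt0// => [z zF|].
  by rewrite fF// normr0 divr_ge0// ltW.
by rewrite mulrC divfK// gt_eqF.
Qed.

(** Delete from [F] points outside [S] as long as [nu] remains determined by the
    rest.  Some point outside [S] always remains, because [f] vanishes on [S]
    and is not killed by [nu]; so the process ends at a point [y] that cannot be
    deleted, which means that [nu] gives it a nonzero weight, of absolute value
    [w]. *)
Lemma essential_point (R : realType) (X : topologicalType)
    (nu : {linear Cp X R -> R^o}) (S F : seq X) (f : Cp X R) :
  determined_by nu F -> (forall x, x \in S -> f x = 0) -> nu f != 0 ->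
  exists (E : seq X) (y : X) (w : R), [/\ y \notin S, 0 < w &
    forall g : Cp X R, (forall x, x \in E -> x != y -> g x = 0) ->
      `|nu g| = w * `|g y| ].
Proof.
move=> + fS nuf; have [n] := ubnP (size F); elim: n F => // n IH F sF nuF.
have [y yF yS] : exists2 y, y \in F & y \notin S.
  apply/hasP; move: nuf; apply: contraNT => /hasPn FS.
  by apply/eqP; apply: nuF => x /FS; rewrite negbK; exact: fS.
have [|] := pselect (determined_by nu [seq x <- F | x != y]).
  apply: IH; move: sF; rewrite ltnS; apply: leq_trans; rewrite size_filter.
  rewrite ltn_neqAle count_size andbT -all_count.
  by apply/allPn; exists y => //=; rewrite eqxx.
move=> /existsNP[h /not_implyP[hF /eqP nuh]].
have hy : h y != 0.
  apply: contra nuh => /eqP hy; apply/eqP/nuF => x xF.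
  by have [->//|xy] := eqVneq x y; apply: hF; rewrite mem_filter xy.
exists F, y, (`|nu h| / `|h y|); split=> //.
  by rewrite divr_gt0// normr_gt0.
move=> g gF; have : nu (g - (g y / h y) *: h) = 0.
  apply: nuF => x xF; rewrite [LHS](_ : _ = g x - g y / h y * h x)//.
  have [->|xy] := eqVneq x y; first by rewrite divfK// subrr.
  by rewrite gF// (hF x) ?mulr0 ?subr0// mem_filter xy.
rewrite linearB linearZ /= => /eqP; rewrite subr_eq0 => /eqP ->.
by rewrite normrM normrM normfV mulrC mulrA mulrAC.
Qed.

(** * Functionals on the space of continuous functions *)

Lemma weak_dual_continuous (R : realType) (V : normedModType R) (phi : dual V) :
  continuous (sval phi : weak V -> R^o).
Proof.
move=> v; apply: (cvg_comp id); last exact: (@initial_continuous _ _ (sval phi)).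
by have /cvg_sup/(_ phi) : nbhs (v : weak V) --> (v : weak V) by [].
Qed.

(** This is where the weak topology enters: it makes the functionals of the
    dual continuous, so that they may be composed with [T]. *)
Lemma pullback_functional (R : realType) (X : topologicalType)
    (V : normedModType R) (T : {linear Cp X R -> weak V}) (phi : dual V) :
  continuous T ->
  exists2 nu : {linear Cp X R -> R^o}, {for 0, continuous nu} &
    forall f, nu f = sval phi (T f).
Proof.
move=> Tc; pose u (f : Cp X R) : R^o := sval phi (T f).
have u_lin : linear u by move=> k f g; rewrite /u linearP [LHS]linearP.
pose U := GRing.isLinear.Build R (Cp X R) R^o *:%R u u_lin.
pose nu : {linear Cp X R -> R^o} := HB.pack u U.
exists nu => //.
exact: (continuous_comp (Tc 0) (@weak_dual_continuous _ _ phi (T 0))).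
Qed.

Lemma evaluation_functional (R : realType) (X : topologicalType)
    (cX : compact [set: X]) (x : X) :
  exists phi : dual (Ck R cX), forall g : Ck R cX, sval phi g = g x.
Proof.
have u_lin : linear (fun g : Ck R cX => g x : R^o) by [].
pose U := GRing.isLinear.Build R (Ck R cX) R^o *:%R _ u_lin.
pose phi : {linear Ck R cX -> R^o} := HB.pack (fun g : Ck R cX => g x : R^o) U.
have phi_cont : continuous phi.
  apply: bounded_linear_continuous; apply/linear_boundedP.
  near=> r => g; apply: (le_trans (sup_norm_ub g x)).
  rewrite -[leLHS]mul1r ler_wpM2r ?sup_norm_ge0//.
by exists (exist _ phi phi_cont).
Unshelve. all: by end_near. Qed.

(** The summable family of weights [a n] at the points [x n] is a discrete
    measure on [X]; it acts on continuous functions with norm at most [2]. *)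
Lemma atomic_functional (R : realType) (X : topologicalType)
    (cX : compact [set: X]) (x : nat -> X) (a : nat -> R) :
  (forall n, 0 <= a n <= geometric 1 2^-1 n) ->
  exists phi : dual (Ck R cX), forall g : Ck R cX,
    series (fun n => a n * g (x n)) @ \oo --> (sval phi g : R).
Proof.
move=> a_geo; have half1 : `|2^-1| < 1 :> R.
  by rewrite gtr0_norm// invf_lt1// ltr1n.
have geo_cvg c : cvgn (series (geometric c (2^-1 : R))).
  exact: is_cvg_geometric_series.
have t_geo (g : Ck R cX) n :
    `|a n * g (x n)| <= geometric (sup_norm g) 2^-1 n.
  have /andP[a0 an] := a_geo n; rewrite normrM ger0_norm// mulrC /geometric /=.
  by rewrite ler_pM// ?sup_norm_ub// (le_trans an)// /geometric /= mul1r.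
have t_ncvg (g : Ck R cX) : cvgn [normed series (fun n => a n * g (x n))].
  apply: series_le_cvg (t_geo g) (geo_cvg _) => // n.
  exact: le_trans (t_geo g n).
have t_cvg (g : Ck R cX) : cvgn (series (fun n => a n * g (x n))).
  exact: normed_cvg.
pose u (g : Ck R cX) : R^o := limn (series (fun n => a n * g (x n))).
have u_lin : linear u.
  move=> k g h; rewrite /u.
  have -> : (fun n => a n * (k *: g + h) (x n)) =
      (k *: (fun n => a n * g (x n)) + (fun n => a n * h (x n))) :> R^nat.
    apply/funext => n.
    rewrite [RHS](_ : _ = k * (a n * g (x n)) + a n * h (x n))//.
    by rewrite mulrCA -mulrDr.
  rewrite lim_seriesD; [by rewrite lim_seriesZ|exact: is_cvg_seriesZ|by []].
pose U := GRing.isLinear.Build R (Ck R cX) R^o *:%R u u_lin.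
pose phi : {linear Ck R cX -> R^o} := HB.pack u U.
have phi_cont : continuous phi.
  apply: bounded_linear_continuous; apply/linear_boundedP.
  near=> r => g.
  rewrite [leLHS](_ : _ = `|limn (series (fun n => a n * g (x n)))|)//.
  rewrite (le_trans (lim_series_norm (t_ncvg g)))//.
  rewrite (le_trans (lim_series_le (t_ncvg g) (geo_cvg _) (t_geo g)))//.
  rewrite (cvg_lim _ (cvg_geometric_series half1))// mulrC.
  by rewrite ler_wpM2r ?sup_norm_ge0//.
by exists (exist _ phi phi_cont) => g; exact: t_cvg.
Unshelve. all: by end_near. Qed.

(** * Bump functions and the dimension of the range *)

Definition has_bumps (R : realType) (X : topologicalType) :=
  forall (y : X) (A : seq X), y \notin A -> exists f : continuousType X R,
    [/\ f y = 1, forall x, x \in A -> f x = 0 & forall x, `|f x| <= 1].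

Lemma metrizable_has_bumps (R : realType) (X : topologicalType) :
  metrizable R X -> has_bumps R X.
Proof.
move=> [d [d0 dE dC dT nbhsd]] y A yA.
have [r r0 rA] : exists2 r : R, 0 < r & forall a, a \in A -> r <= d y a.
  elim: A yA => [|a A IH]; first by exists 1.
  rewrite inE negb_or => /andP[ya /IH[r r0 rA]].
  exists (Num.min r (d y a)) => [|b]; last first.
    by rewrite inE => /orP[/eqP ->|/rA rb]; rewrite ge_min ?lexx ?orbT// rb.
  rewrite lt_min r0 lt_neqAle d0 andbT eq_sym.
  by apply: contra ya => /eqP/dE ->.
(* A cone around [y] of radius [r], the distance from [y] to [A] or less. *)
pose f (x : X) : R^o := Num.max (1 - d y x / r) 0.
have dcont : continuous (d y : X -> R^o).
  move=> x; apply/cvgrPdist_lt => e e0.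
  suff : nbhs x [set z | `|d y x - d y z| < e] by [].
  rewrite nbhsd.
  exists e => //= z /= xz; rewrite ltr_norml; apply/andP; split.
    rewrite ltrNl opprB ltrBlDr (le_lt_trans (dT y x z))//.
    by rewrite addrC ltrD2r.
  rewrite ltrBlDr (le_lt_trans (dT y z x))// addrC ltrD2r.
  by rewrite dC.
have fcont : continuous f.
  move=> x; apply: (@continuous_max _ _ (fun x => 1 - d y x / r : R^o) (cst 0)).
    apply: cvgB; first exact: cvg_cst.
    by apply: cvgMr_tmp; exact: dcont.
  exact: cst_continuous.
pose g : continuousType X R := mkcts fcont.
have fE x : g x = Num.max (1 - d y x / r) 0 by [].
exists g; split.
- by rewrite fE (dE _ _).2// mul0r subr0 max_l.
- move=> x /rA rx; rewrite fE max_r// subr_le0.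
  by rewrite ler_pdivlMr// mul1r.
- move=> x; rewrite fE ger0_norm ?le_max ?lexx ?orbT//.
  by rewrite ge_max ler01 andbT gerBl divr_ge0// ltW.
Qed.

Lemma infinite_choice_injection (X : choiceType) :
  infinite_set [set: X] -> exists p : nat -> X, injective p.
Proof.
move=> /infiniteP/card_leP[f]; exists (fun n => set_val (f (to_setT n))).
move=> m n /val_inj /(@inj _ _ _ f).
by rewrite !in_setT => /(_ isT isT) /(congr1 set_val).
Qed.

(** Restrictions to [S] live in a space of dimension at most [size S]. *)
Lemma dependent_functions (R : realType) (X : topologicalType) (n : nat)
    (S : seq X) (g : 'I_n -> Cp X R) : (size S < n)%N ->
  exists2 v : 'I_n -> R, exists i, v i != 0 &
    forall s, s \in S -> \sum_i v i * g i s = 0.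
Proof.
move=> Sn; pose A := \matrix_(i < n, j < size S) g i (tnth (in_tuple S) j).
have : kermx A != 0.
  rewrite kermx_eq0 /row_free neq_ltn (leq_ltn_trans (rank_leq_col A))//.
case/rowV0Pn => v /sub_kermxP vA /rV0Pn[i vi].
exists (v 0); first by exists i.
move=> s /(tnthP (in_tuple S))[j ->].
move/matrixP: vA => /(_ 0 j); rewrite !mxE => vA0; rewrite -[RHS]vA0.
by apply: eq_bigr => k _; rewrite !mxE.
Qed.

(** If [T] killed all functions vanishing on [S], a nontrivial combination of
    preimages of [size S + 1] functions in biorthogonal position with points
    [p j] could be chosen to vanish on [S]; applying [T] and evaluating at the
    [p j] would then make all its coefficients zero. *)
Lemma infinite_range (R : realType) (X : topologicalType)
    (cX : compact [set: X]) (T : {linear Cp X R -> weak (Ck R cX)})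
    (S : seq X) :
  infinite_set [set: X] -> has_bumps R X ->
  range T = [set: weak (Ck R cX)] ->
  exists (x : X) (f : Cp X R), (forall s, s \in S -> f s = 0) /\
    (T f : Ck R cX) x != 0.
Proof.
move=> /infinite_choice_injection[p p_inj] bumps Tsurj.
apply: contrapT => noxf.
have T0 (f : Cp X R) x :
    (forall s, s \in S -> f s = 0) -> (T f : Ck R cX) x = 0.
  by move=> fS; apply: contrapT => /eqP Tfx; apply: noxf; exists x, f.
have /choice[g gP] (i : 'I_(size S).+1) : exists g : Cp X R,
    forall j : 'I_(size S).+1, (T g : Ck R cX) (p j) = (j == i)%:R.
  have [|e [ei e0 _]] :=
    bumps (p i) [seq p j | j <- iota 0 (size S).+1 & j != val i].
    by rewrite mem_map// mem_filter eqxx.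
  have [g _ Tg] : range T (e : Ck R cX) by rewrite Tsurj.
  exists g => j; rewrite Tg; have [->//|ji] := eqVneq j i.
  by rewrite e0// mem_map// mem_filter mem_iota ji leq0n add0n ltn_ord.
have [v [i vi] vS] := dependent_functions g (ltnSn (size S)).
have sumE (h : 'I_(size S).+1 -> continuousType X R) x :
    (\sum_k v k *: h k) x = \sum_k v k * h k x.
  by elim/big_rec2 : _ => // k a b _ <-.
have Tv : (T (\sum_k v k *: g k) : Ck R cX) (p i) = 0.
  by apply: T0 => s sS; rewrite [LHS]sumE vS.
move/eqP: vi; apply; rewrite -Tv linear_sum.
under eq_bigr do rewrite linearZ.
rewrite [RHS](sumE (fun k => T (g k))) (bigD1 i)//= gP eqxx mulr1.
by rewrite big1 ?addr0// => k ki; rewrite gP eq_sym (negbTE ki) mulr0.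
Qed.

(** * The gliding hump *)

(** Here [D n] stands for a finite set determining the functionals before step
    [n], and [w n] for the absolute value of the weight that [nu n] gives to the new
    point [y n].  The weights [a n] are chosen so that, for a bump [f] at [y i]
    vanishing at the other points of [D i.+1], the [i]-th term dominates the
    sum of all later ones; as the earlier ones vanish, the sum of the series is
    nonzero. *)
Lemma gliding_hump (R : realType) (X : topologicalType)
    (nu : nat -> {linear Cp X R -> R^o}) (y : nat -> X) (D : nat -> seq X)
    (C w : nat -> R) :
  has_bumps R X ->
  (forall n, y n \notin D n) -> (forall n, y n \in D n.+1) ->
  (forall n, {subset D n <= D n.+1}) ->
  (forall n, [/\ 0 < w n, w n <= C n & 1 <= C n]) ->
  (forall n (f : Cp X R), (forall x, x \in D n.+1 -> x != y n -> f x = 0) ->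
    `|nu n f| = w n * `|f (y n)|) ->
  (forall n (f : Cp X R), (forall x, `|f x| <= 1) -> `|nu n f| <= C n) ->
  exists a : nat -> R, (forall n, 0 <= a n <= geometric 1 2^-1 n) /\
    forall F : seq X, exists f : Cp X R, (forall x, x \in F -> f x = 0) /\
      ~ (series (fun n => a n * nu n f) @ \oo --> (0 : R)).
Proof.
move=> bumps yD yD1 DS wC nuw nuC.
(* [b n] will be [a n * C n], a bound for the [n]-th term of the series; the
   factor [w n / (4 * C n)] makes [b n.+1] a quarter of [a n * w n]. *)
have [b [b_0 bS]] : exists b : nat -> R,
    b 0%N = 1 /\ forall n, b n.+1 = b n * (w n / C n / 4).
  by exists (fix b n := if n is m.+1 then b m * (w m / C m / 4) else 1).
have C0 n : 0 < C n by have [_ _ C1] := wC n; exact: lt_le_trans C1.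
have b0 n : 0 < b n.
  elim: n => [|n IH]; rewrite ?b_0 ?ltr01// bS.
  by have [w0 _ _] := wC n; rewrite mulr_gt0// !divr_gt0.
have b_half n : b n.+1 <= b n / 2.
  rewrite bS ler_pM2l// ler_pdivrMr// ler_pdivrMr//.
  have [_ wCn _] := wC n; apply: (le_trans wCn).
  have := C0 n; lra.
pose a n := b n / C n.
have bg n : b n <= geometric 1 2^-1 n.
  elim: n => [|n IH]; first by rewrite b_0 /geometric /= mul1r expr0.
  rewrite (le_trans (b_half n))// /geometric /= exprSr mulrA ler_pM2r//.
have a0 n : 0 < a n by rewrite divr_gt0.
exists a; split=> [n|F].
  rewrite ltW//= (le_trans _ (bg n))// ler_pdivrMr// ler_peMr//.
    exact: ltW.
  by have [] := wC n.
have DM m n : (m <= n)%N -> {subset D m <= D n}.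
  move=> /subnK <-; elim: (n - m)%N => // k IH x /IH.
  by rewrite addSn; exact: DS.
(* The [y n] are distinct, so one of them avoids the finite set [F]. *)
have [i yi] : exists i, y i \notin F.
  have y_inj : injective y.
    have lt_neq m n : (m < n)%N -> y m <> y n.
      by move=> mn e; have := yD n; rewrite -e (DM _ _ mn).
    move=> m n; case: (ltngtP m n) => // [/lt_neq|/lt_neq h /esym] //.
  have /allPn[_ /mapP[i _ ->] yi] : ~~ all (mem F) (map y (iota 0 (size F).+1)).
    apply/negP => /allP/uniq_leq_size; rewrite map_inj_uniq// iota_uniq.
    by rewrite size_map size_iota ltnn => /(_ isT).
  by exists i.
have [|f [fy fA f1]] := bumps (y i) [seq x <- F ++ D i.+1 | x != y i].
  by rewrite mem_filter eqxx.
have fD x : x \in D i.+1 -> x != y i -> f x = 0.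
  by move=> xD xy; apply: fA; rewrite mem_filter xy mem_cat xD orbT.
exists f; split=> [x xF|].
  apply: fA; rewrite mem_filter mem_cat xF andbT.
  by apply: contraNneq yi => <-.
set t : R^nat := fun n => a n * nu n f => t0.
have tlt n : (n < i)%N -> t n = 0.
  move=> ni; have f0 x : x \in D n.+1 -> f x = 0.
    move=> xD; apply: fD; first exact: DM (leqW ni) _ xD.
    apply: contraTneq xD => ->; apply: contra (yD i).
    exact: DM ni _.
  suff : `|nu n f| = 0 by move/normr0_eq0 => nf; rewrite /t nf mulr0.
  rewrite nuw => [|x /f0//].
  by rewrite f0 ?normr0 ?mulr0.
have ti : `|t i| = 4 * b i.+1.
  rewrite /t normrM gtr0_norm// nuw// fy normr1 mulr1 /a bS.
  by field; rewrite gt_eqF.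
have tle n : `|t n| <= b n.
  rewrite /t normrM gtr0_norm// /a mulrAC ler_pdivrMr// ler_pM2l//.
  exact: nuC.
(* Each step of the induction loses at most [b (i.+1 + k)], which the halving of
   [b] pays for. *)
have low k : 2 * b i.+1 + 2 * b (i.+1 + k)%N <= `|series t (i.+1 + k)%N|.
  elim: k => [|k IH].
    rewrite addn0 /series /= big_nat_recr//= big_nat big1 ?add0r ?ti//.
    lra.
  rewrite addnS /series /= big_nat_recr//= -/(series t _).
  have := lerB_normD (series t (i.+1 + k)%N) (t (i.+1 + k)%N).
  have := tle (i.+1 + k)%N; have := b_half (i.+1 + k)%N.
  rewrite /series /= in IH *; lra.
move/cvgr0Pnorm_lt : t0 => /(_ (b i.+1) (b0 _)) [N _ /(_ (i.+1 + N)%N)] /=.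
rewrite leq_addl => /(_ isT); have := low N.
have := b0 i.+1; have := b0 (i.+1 + N)%N; lra.
Qed.

(** The finite sets [D n] are built by iterating a choice function [q], which sends
    a finite set [S] to a point [x], a new point [y] with weight [w], a bound [C]
    and an enlargement of [S] that contains [y] and determines [nu x]. *)
Lemma no_continuous_surjection (R : realType) (X : topologicalType)
    (cX : compact [set: X]) (T : {linear Cp X R -> weak (Ck R cX)}) :
  infinite_set [set: X] -> has_bumps R X -> continuous T ->
  range T <> [set: weak (Ck R cX)].
Proof.
move=> infX bumps Tc Tsurj.
have /choice[nu /all_and2[nu_cont nuE]] (x : X) :
    exists nu : {linear Cp X R -> R^o}, {for 0, continuous nu} /\
      forall f, nu f = (T f : Ck R cX) x.
  have [phi phiE] := evaluation_functional R cX x.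
  have [nu nuc nuE] := pullback_functional phi Tc.
  by exists nu; split=> // f; rewrite nuE phiE.
have nu_bound x : exists C, 1 <= C /\
    forall f : Cp X R, (forall z, `|f z| <= 1) -> `|nu x f| <= C.
  have [F [C [_ nuC]]] := Cp_functional_finite (nu_cont x).
  exists (Num.max 1 C); split=> [|f f1]; first by rewrite le_max lexx.
  by rewrite le_max orbC -[C]mulr1 nuC.
have /choice[q qP] (S : seq X) : exists q : (X * X) * seq X * (R * R),
    let: (x, y, E, (C, w)) := q in
    [/\ y \notin S, y \in E, {subset S <= E}, [/\ 0 < w, w <= C & 1 <= C] &
      (forall f : Cp X R, (forall z, z \in E -> z != y -> f z = 0) ->
        `|nu x f| = w * `|f y|) /\
      (forall f : Cp X R, (forall z, `|f z| <= 1) -> `|nu x f| <= C)].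
  have [x [f [fS Tfx]]] := infinite_range S infX bumps Tsurj.
  rewrite -nuE in Tfx; have [F nuF] := Cp_functional_determined (nu_cont x).
  have [E [y [w [yS w0 nuy]]]] := essential_point nuF fS Tfx.
  have [C [C1 nuC]] := nu_bound x.
  exists (x, y, y :: S ++ E, (Num.max C w, w)); split=> //.
  - by rewrite inE eqxx.
  - by move=> z zS; rewrite inE mem_cat zS orbT.
  - by rewrite !le_max lexx C1 orbT.
  - split=> [g gE|g g1]; last by rewrite le_max nuC.
    by apply: nuy => z zE; apply: gE; rewrite inE mem_cat zE !orbT.
pose D n := iter n (fun S => (q S).1.2) [::].
have [||||||a [a_geo hump]] := @gliding_hump _ _ (fun n => nu (q (D n)).1.1.1)
  (fun n => (q (D n)).1.1.2) D (fun n => (q (D n)).2.1) (fun n => (q (D n)).2.2)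
  bumps.
1-6: by move=> n; rewrite ?[D n.+1]iterS -/(D n);
  case: (q (D n)) (qP (D n)) => [[[x y] E] [C w]] [? ? ? ? []].
have [phi phiE] := atomic_functional cX (fun n => (q (D n)).1.1.1) a_geo.
have [mu mu_cont muE] := pullback_functional phi Tc.
have [F muF] := Cp_functional_determined mu_cont.
have [f [fF]] := hump F; apply.
rewrite -(muF f fF) muE; have := phiE (T f).
by under eq_fun do rewrite -nuE.
Qed.

Theorem theorem4p4 (R : realType) (X : topologicalType)
    (cX : compact [set: X]) :
  infinite_set [set: X] -> metrizable R X -> C_space X ->
  ~ exists T : {linear Cp X R -> weak (Ck R cX)},
      continuous T /\ range T = [set: weak (Ck R cX)].
Proof.
move=> infX metX _ [T [Tc Tsurj]].
exact: (no_continuous_surjection infX (metrizable_has_bumps metX) Tc Tsurj).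
Qed.
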